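(* Let $\bar\delta>0$ and let $L_\delta:L^2\to L^2$, $\delta\in[0,\bar\delta)$, be a family of compact linear operators preserving the integral: for each $g\in L^2$, $\int L_\delta g\,dm=\int g\,dm$. Then: (I) For each $\delta$ there is $g_\delta\in L^2$, $g_\delta\neq 0$, with $L_\delta g_\delta=g_\delta$. (II) Suppose in addition that (A1) holds: for every $g\in V$, $\lim_{n\to\infty}\|L_0^n g\|_2=0$. Then $L_0$ has a unique invariant function $f_0$ (i.e. $L_0f_0=f_0$) with $\int f_0\,dm=1$. Furthermore $L_0$ has exponential contraction of the zero average space $V$. (III) Suppose in addition to (A1) that (A2) holds: there is $K\ge 0$ such that $\|L_\delta-L_0\|_{L^2\to L^2}\le K\delta$ for all small $\delta$, and there is $\hat f\in V$ such that $\lim_{\delta\to0}\frac{L_\delta-L_0}{\delta}f_0=\hat f$ (in $L^2$). Then: (a) there is $\delta_2>0$ such that for each $0\le\delta<\delta_2$ the operator $L_\delta$ has a unique invariant function $f_\delta\in L^2$ with $\int f_\delta\,dm=1$; (b) the resolvent operator $(\mathrm{Id}-L_0)^{-1}:V\to V$ is (well defined and) continuous; (c) $\displaystyle\lim_{\delta\to0}\left\|\frac{f_\delta-f_0}{\delta}-(\mathrm{Id}-L_0)^{-1}\hat f\right\|_2=0$.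
   Context: $L^2=L^2([0,1])$ is the space of (real-valued) square-integrable functions on $[0,1]$ with Lebesgue measure $m$, with norm $\|\cdot\|_2$. $V:=\{f\in L^2:\int f\,dm=0\}$. An operator $L:L^2\to L^2$ has exponential contraction of the zero average space $V$ if there are $C\ge0$ and $\lambda<0$ such that $\|L^ng\|_2\le Ce^{\lambda n}\|g\|_2$ for all $g\in V$ and all $n\ge0$. Limits $\delta\to0$ are along $\delta>0$. Operators are not assumed positive. *)

(* Defs.v *)
From HB Require Import structures.
From mathcomp Require Import all_boot all_order all_algebra.
From mathcomp Require Import all_classical all_reals all_analysis.
From mathcomp Require Import measurable_realfun ess_sup_inf.
Set Implicit Arguments.
Unset Strict Implicit.
Unset Printing Implicit Defensive.
Import Order.TTheory GRing.Theory Num.Theory.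
Import numFieldNormedType.Exports.
Local Open Scope classical_set_scope.
Local Open Scope ring_scope.
Local Open Scope quotient_scope.

(* The library's LspaceType mu p1 is a type of classes of a.e. equal functions
   (each coerces to a function through a chosen representative) without any
   structure; it is made a normed module here. *)

Lemma ae_eq_Lnorm d (T : measurableType d) (R : realType)
    (mu : {measure set T -> \bar R}) (p : \bar R) (f g : T -> R) :
  (1 <= p)%E -> measurable_fun setT f -> measurable_fun setT g ->
  f = g %[ae mu] -> 'N[mu]_p[EFin \o f]%E = 'N[mu]_p[EFin \o g]%E.
Proof.
move=> p1 mf mg fg; rewrite unlock; case: p p1 => [r _|_|//].
- congr poweR; apply: ae_eq_integral => //.
  + apply/measurable_EFinP; apply: (measurableT_comp (measurable_powR _)) => //.
    exact: measurableT_comp.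
  + apply/measurable_EFinP; apply: (measurableT_comp (measurable_powR _)) => //.
    exact: measurableT_comp.
  + by apply: filterS fg => x + _ => /= ->.
- case: ifPn => // _; apply: eq_ess_sup.
  by apply: filterS fg => x /= ->.
Qed.

Section Lspace_normed.
Context d (T : measurableType d) (R : realType).
Variables (mu : {measure set T -> \bar R}) (p : \bar R) (p1 : (1 <= p)%E).
Local Notation Q := {mfun_ mu, T >-> measurableTypeR R}.
Local Notation Lf := (LfunType mu p1).
Local Notation L := (LspaceType mu p1).

(* The values of LspaceType are classes of {mfun T >-> measurableTypeR R}, which
   differs from {mfun T >-> R} by the display of the Borel sets. *)
Let toR (f : {mfun T >-> R}) : {mfun T >-> measurableTypeR R} :=
  HB.pack (f : T -> measurableTypeR R)
    (isMeasurableFun.Build _ _ T (measurableTypeR R) f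
      (@measurable_funPT _ _ _ _ f)).

Let ae_class (f : {mfun T >-> R}) : Q := \pi_Q (toR f).

Let ae_classE (f : {mfun T >-> R}) : (ae_class f : T -> R) = f %[ae mu].
Proof.
have /eqmodP/asboolP : \pi_Q (repr (ae_class f)) = \pi_Q (toR f).
  by rewrite reprK.
by [].
Qed.

Let measurable_repr (f : Q) : measurable_fun setT (f : T -> R).
Proof. exact: (@measurable_funPT _ _ _ _ (repr f)). Qed.

Let finite_norm_class (f : Lf) : finite_norm mu p (ae_class f : T -> R).
Proof.
rewrite /finite_norm (@ae_eq_Lnorm _ _ _ _ _ _ f)//.
exact: Lfunction_finite.
Qed.

Definition Lspace_class (f : Lf) : L :=
  HB.pack (ae_class f) (isFinLebesgue.Build _ _ _ mu p p1 _ (finite_norm_class f)).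

Let Lspace_Lfun (f : L) : (f : T -> R) \in Lfun mu p.
Proof.
apply/andP; split; rewrite inE/=; first exact: measurable_repr.
exact: Lebesgue_finite.
Qed.

Definition Lspace_repr (f : L) : Lf := Lfun_Sub p1 (Lspace_Lfun f).

Lemma Lspace_classE (f : Lf) : (Lspace_class f : T -> R) = f %[ae mu].
Proof. exact: ae_classE. Qed.

Lemma Lspace_eqP (f g : L) : f = g <-> (f : T -> R) = g %[ae mu].
Proof.
split=> [->|fg]; first exact: ae_eq_refl.
have fgQ : f = g :> Q.
  rewrite -[LHS]reprK -[RHS]reprK.
  by apply/eqmodP/asboolP.
case: f g fgQ {fg} => f [[hf]] [g [[hg]]] /= fg; rewrite -{g}fg in hg *.
by congr LebesgueSpace.Pack; congr LebesgueSpace.Class;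
  congr isFinLebesgue.Axioms_; exact: Prop_irrelevance.
Qed.

HB.instance Definition _ := gen_eqMixin L.
HB.instance Definition _ := gen_choiceMixin L.

Let add (f g : L) : L := Lspace_class (Lspace_repr f + Lspace_repr g).
Let opp (f : L) : L := Lspace_class (- Lspace_repr f).
Let scale (a : R) (f : L) : L := Lspace_class (a *: Lspace_repr f).
Let zero : L := Lspace_class 0.

Let addE f g : (add f g : T -> R) = (f : T -> R) \+ g %[ae mu].
Proof. exact: Lspace_classE. Qed.
Let oppE f : (opp f : T -> R) = \- (f : T -> R) %[ae mu].
Proof. exact: Lspace_classE. Qed.
Let scaleE a f : (scale a f : T -> R) = a \*: (f : T -> R) %[ae mu].
Proof. exact: Lspace_classE. Qed.
Let zeroE : (zero : T -> R) = cst 0 %[ae mu].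
Proof. exact: Lspace_classE. Qed.

Let ae_app (P Q : T -> Prop) : (\forall x \ae mu, P x) ->
  (\forall x \ae mu, P x -> Q x) -> \forall x \ae mu, Q x.
Proof. by apply: filterS2 => x Px; apply. Qed.

Let addA : associative add.
Proof.
move=> f g h; apply/Lspace_eqP.
apply: (ae_app (addE f (add g h))); apply: (ae_app (addE g h)).
apply: (ae_app (addE (add f g) h)); apply: (ae_app (addE f g)).
apply: aeW => x /= e4 e3 e2 e1 _.
by rewrite e1// e2// e3// e4// addrA.
Qed.

Let addC : commutative add.
Proof.
move=> f g; apply/Lspace_eqP; move: (addE f g) (addE g f).
by apply: filterS2 => x /= e1 e2 _; rewrite e1// e2// addrC.
Qed.

Let add0 : left_id zero add.
Proof.
move=> f; apply/Lspace_eqP; move: (addE zero f) zeroE.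
by apply: filterS2 => x /= e1 e2 _; rewrite e1// e2// add0r.
Qed.

Let addN : left_inverse zero opp add.
Proof.
move=> f; apply/Lspace_eqP; move: (addE (opp f) f) (oppE f) zeroE.
by apply: filterS3 => x /= e1 e2 e3 _; rewrite e1// e2// e3// addNr.
Qed.

HB.instance Definition _ := GRing.isZmodule.Build L addA addC add0 addN.

Let scaleA a b f : scale a (scale b f) = scale (a * b) f.
Proof.
apply/Lspace_eqP; move: (scaleE a (scale b f)) (scaleE b f) (scaleE (a * b) f).
by apply: filterS3 => x /= e1 e2 e3 _; rewrite e1// e2// e3// scalerA.
Qed.

Let scale1 : left_id 1 scale.
Proof.
move=> f; apply/Lspace_eqP; move: (scaleE 1 f).
by apply: filterS => x /= e1 _; rewrite e1// scale1r.
Qed.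

Let scaleDr : right_distributive scale +%R.
Proof.
move=> a f g; apply/Lspace_eqP.
apply: (ae_app (scaleE a (add f g))); apply: (ae_app (addE f g)).
apply: (ae_app (addE (scale a f) (scale a g))).
apply: (ae_app (scaleE a f)); apply: (ae_app (scaleE a g)).
apply: aeW => x /= e5 e4 e3 e2 e1 _.
by rewrite e1// e2// e3// e4// e5// scalerDr.
Qed.

Let scaleDl f : {morph scale^~ f : a b / a + b}.
Proof.
move=> a b; apply/Lspace_eqP.
apply: (ae_app (scaleE (a + b) f)).
apply: (ae_app (addE (scale a f) (scale b f))).
apply: (ae_app (scaleE a f)); apply: (ae_app (scaleE b f)).
apply: aeW => x /= e4 e3 e2 e1 _.
by rewrite e1// e2// e3// e4// scalerDl.
Qed.

HB.instance Definition _ :=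
  GRing.Zmodule_isLmodule.Build R L scaleA scale1 scaleDr scaleDl.

Definition Lspace_norm (f : L) : R := fine 'N[mu]_p[EFin \o f]%E.

Let norm_class (f : Lf) :
  Lspace_norm (Lspace_class f) = fine 'N[mu]_p[EFin \o f]%E.
Proof.
congr fine; apply: ae_eq_Lnorm => //.
exact: Lspace_classE.
Qed.

Let ler_normD f g :
  Lspace_norm (f + g) <= Lspace_norm f + Lspace_norm g.
Proof. by rewrite norm_class; exact: (ler_LnormD (Lspace_repr f)). Qed.

Let normrZ a f : Lspace_norm (a *: f) = `|a| * Lspace_norm f.
Proof.
rewrite norm_class.
rewrite (_ : 'N[mu]_p[_] = `|a|%:E * 'N[mu]_p[EFin \o Lspace_repr f])%E.
  by rewrite fineM// -finite_norm_fine.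
exact: LnormZ.
Qed.

Let normr0_eq0 f : Lspace_norm f = 0 -> f = 0.
Proof.
move=> /(@fine_Lnormr_eq0 _ _ _ _ _ p1 (Lspace_repr f)) f0; apply/Lspace_eqP.
by move: f0 zeroE; apply: filterS2 => x /= e1 e2 _; rewrite e1// e2.
Qed.

HB.instance Definition _ :=
  Lmodule_isNormed.Build R L ler_normD normrZ normr0_eq0.

Lemma Lspace_normE (f : L) : `|f| = fine 'N[mu]_p[EFin \o f]%E.
Proof. by []. Qed.

Lemma Lspace_addE (f g : L) : (f + g : T -> R) = (f : T -> R) \+ g %[ae mu].
Proof. exact: addE. Qed.

Lemma Lspace_oppE (f : L) : (- f : T -> R) = \- (f : T -> R) %[ae mu].
Proof. exact: oppE. Qed.

Lemma Lspace_scaleE (a : R) (f : L) : (a *: f : T -> R) = a \*: (f : T -> R) %[ae mu].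
Proof. exact: scaleE. Qed.

Lemma Lspace_zeroE : ((0 : L) : T -> R) = cst 0 %[ae mu].
Proof. exact: zeroE. Qed.

End Lspace_normed.

Section operators.
Context (R : realType) (U W : normedModType R).

Definition compact_operator (T : U -> W) : Prop :=
  forall A : set U, bounded_set A -> precompact (T @` A).

(* Extended-real valued: +oo for an unbounded operator. *)
Definition operator_norm (T : U -> W) : \bar R :=
  ereal_sup [set (`|T x|)%:E | x in [set x : U | `|x| <= 1]].

End operators.

(* Lebesgue measure on [0, 1], as a measure on R that vanishes outside [0, 1];
   functions on R modulo its null sets are functions on [0, 1] modulo Lebesgue
   null sets. *)
Definition lebesgue01 (R : realType) :
    {measure set (measurableTypeR R) -> \bar R} :=
  mrestr (@lebesgue_measure R)
    (measurable_itv `[0%R, 1%R] :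
      measurable (`[0%R, 1%R]%classic : set (measurableTypeR R))).

Notation L2 R := (LspaceType2 (lebesgue01 R)).

Section L2_unit_interval.
Context (R : realType).
Implicit Types (T : L2 R -> L2 R) (f g : L2 R).

Definition integral01 f : R := \int[lebesgue01 R]_x f x.

Definition zero_average : set (L2 R) := [set g | integral01 g = 0].

Definition preserves_integral T : Prop :=
  forall g, integral01 (T g) = integral01 g.

Definition normalized_invariant T f : Prop := T f = f /\ integral01 f = 1.

Definition convergence_to_equilibrium T : Prop :=
  forall g, zero_average g -> `|iter n T g| @[n --> \oo] --> (0 : R).

Definition exponential_contraction T : Prop :=
  exists C lambda : R, [/\ 0 <= C, lambda < 0 &
    forall g, zero_average g -> forall n : nat,
      `|iter n T g| <= C * expR (lambda * n%:R) * `|g|].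

(* The inverse of Id - T : V -> V, where V is the zero average space; it is a
   genuine inverse only when Id - T is a bijection of V. *)
Definition resolvent T : L2 R -> L2 R :=
  'pinv_(fun=> 0) zero_average (fun g => g - T g).

End L2_unit_interval.

(* Main.v *)
Require Import Defs.
From HB Require Import structures.
From mathcomp Require Import all_boot all_order all_algebra.
From mathcomp Require Import all_classical all_reals all_analysis.
From mathcomp Require Import measurable_realfun lra ring.
Set Implicit Arguments.
Unset Strict Implicit.
Unset Printing Implicit Defensive.
Import Order.TTheory GRing.Theory Num.Theory.
Import numFieldNormedType.Exports.
Local Open Scope classical_set_scope.
Local Open Scope ring_scope.

(* Everything rests on cluster points of images of bounded sequences under a
   compact operator; completeness of L^2 is never needed.

   If Id - L_d were injective it would be onto (Riesz), but its range lies in V,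
   which is proper because L_d preserves the integral: this gives the invariant
   function of (I). Under (A1) the operator L_0 has no fixed point in V other
   than 0, so Id - L_0 is bounded below on V, hence a bijection of V with
   continuous inverse, and compactness upgrades the pointwise convergence to
   ||L_0^N|| <= 1/2 on V for some N. The lower bound survives a perturbation of
   size K d, which gives uniqueness for small d.

   For the response, h_d := (f_d - f_0) / d and r_d := (L_d - L_0) f_0 / d
   satisfy (Id - L_d) h_d = r_d, so that h_d is bounded and
   (Id - L_0) h_d = r_d + (L_d - L_0) h_d tends to fhat. *)

(** * Compact operators on normed spaces *)

Section compact_operators.
Context (R : realType) (X : normedModType R).
Implicit Types (V A : set X) (x y z : X).

Definition linear_subspace V :=
  V 0 /\ forall (a : R) x y, V x -> V y -> V (a *: x + y).

Lemma linear_subspaceZ V a x : linear_subspace V -> V x -> V (a *: x).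
Proof. by move=> [V0 VZ] Vx; rewrite -[_ *: _]addr0; exact: VZ. Qed.

Lemma linear_subspaceD V x y : linear_subspace V -> V x -> V y -> V (x + y).
Proof. by move=> [V0 VZ] Vx Vy; rewrite -[x]scale1r; exact: VZ. Qed.

Lemma linear_subspaceB V x y : linear_subspace V -> V x -> V y -> V (x - y).
Proof. by move=> [V0 VZ] Vx Vy; rewrite addrC -scaleN1r; exact: VZ. Qed.

Lemma closed_approx A z : closed A ->
  (forall e : R, 0 < e -> exists2 x, A x & `|x - z| < e) -> A z.
Proof.
move=> clA Az; apply: clA => U /nbhs_ballP[e/= e0 zeU].
have [x Ax xz] := Az _ e0.
exists x; split => //; apply: zeU.
by rewrite -ball_normE /= distrC.
Qed.

Lemma norm_le_eps x : (forall e : R, 0 < e -> `|x| <= e) -> x = 0.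
Proof.
move=> xe; apply/eqP; rewrite -normr_le0.
by apply/ler_addgt0Pl => e e0; rewrite addr0 xe.
Qed.

Lemma norm_bounded_set A (B : R) : (forall x, A x -> `|x| <= B) -> bounded_set A.
Proof.
move=> AB; exists B; split; first exact: num_real.
by move=> M BM x Ax; rewrite /= (le_trans (AB _ Ax))// ltW.
Qed.

(** The distance from [x0] to [A] is positive because [A] is closed. It may not be attained, so
    [x0 - y0] is normalized for some [y0] in [A] realizing it up to a factor 2. *)
Lemma riesz_almost_orthogonal V A x0 : linear_subspace V -> closed A ->
  linear_subspace A ->
  A `<=` V -> V x0 -> ~ A x0 ->
  exists x, [/\ V x, `|x| <= 1 & forall y, A y -> 2^-1 <= `|x - y|].
Proof.
move=> subV clA subA AV Vx0 Ax0.
pose D := [set `|x0 - y| | y in A].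
have D0 : D !=set0 by exists `|x0 - 0|; exists 0 => //; case: subA.
have lbD : lbound D 0 by move=> _ [y _ <-].
have hD : has_inf D by split => //; exists 0.
have infle y : A y -> inf D <= `|x0 - y|.
  by move=> Ay; apply: ge_inf; [exists 0|exists y].
have d0 : 0 < inf D.
  rewrite lt_neqAle lb_le_inf// andbT; apply/eqP => d0; apply: Ax0.
  apply: closed_approx => // e e0.
  have [_ [y Ay <-]] := inf_adherent e0 hD.
  by rewrite -d0 add0r distrC; exists y.
(* Taking [inf D] itself as the tolerance gives [|x0 - y0| < 2 * inf D], the source of the bound
   [2^-1]. *)
have [_ [y0 Ay0 <-]] := inf_adherent d0 hD => y0lt.
have n0 : 0 < `|x0 - y0| by rewrite (lt_le_trans d0)// infle.
exists (`|x0 - y0|^-1 *: (x0 - y0)); split.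
- by apply: linear_subspaceZ => //; apply: linear_subspaceB => //; exact: AV.
- by rewrite normrZ ger0_norm ?invr_ge0// mulVf// gt_eqF.
move=> y Ay.
have -> : `|x0 - y0|^-1 *: (x0 - y0) - y =
    `|x0 - y0|^-1 *: (x0 - (`|x0 - y0| *: y + y0)).
  rewrite [_ *: y + y0]addrC opprD addrA [RHS]scalerBr.
  by rewrite scalerA mulVf ?gt_eqF// scale1r.
rewrite normrZ ger0_norm ?invr_ge0// mulrC ler_pdivlMr//.
have := infle _ (proj2 subA `|x0 - y0| _ _ Ay Ay0).
by lra.
Qed.

(** * Riesz theory of [Id - K] for a compact operator [K] *)

Section one_operator.
Variable K : {linear X -> X}.

Lemma sub_idB x y : (x - y) - K (x - y) = (x - K x) - (y - K y).
Proof. by rewrite linearB !opprD addrACA. Qed.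

Lemma sub_idP a x y : (a *: x + y) - K (a *: x + y) = a *: (x - K x) + (y - K y).
Proof. by rewrite linearP opprD addrACA scalerBr. Qed.

Hypothesis Kcpt : compact_operator K.

Lemma compact_operator_bounded :
  exists2 B : R, 0 < B & forall x, `|K x| <= B * `|x|.
Proof.
have : bounded_set [set x : X | `|x| <= 1] by exact: (@norm_bounded_set _ 1).
move=> /Kcpt; rewrite precompactE => /compact_bounded/pinfty_ex_gt0[M M0 KM].
exists M => // x; have [->|x0] := eqVneq x 0; first by rewrite linear0 !normr0 mulr0.
have nx : 0 < `|x| by rewrite normr_gt0.
rewrite -ler_pdivrMr// mulrC.
have -> : `|x|^-1 * `|K x| = `|K (`|x|^-1 *: x)|.
  by rewrite linearZ/= normrZ ger0_norm// invr_ge0 ltW.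
apply: KM; apply: subset_closure; exists (`|x|^-1 *: x) => //=.
by rewrite normrZ ger0_norm ?invr_ge0// mulVf// gt_eqF.
Qed.

(** Compactness in the form used below: [z] is a cluster point of [K \o u] along [\oo], approached
    at arbitrarily large indices, so no subsequence has to be extracted. *)
Lemma compact_operator_cluster (B : R) (u : nat -> X) :
  (forall n, `|u n| <= B) ->
  exists z, forall (e : R) (N : nat), 0 < e ->
    exists2 n, (N <= n)%N & `|K (u n) - z| < e.
Proof.
move=> uB.
have : bounded_set [set u n | n in setT].
  by apply: (@norm_bounded_set _ B) => _ [n _ <-].
move=> /Kcpt; rewrite precompactE => /(_ ((K \o u) @ \oo)).
case.
  exists 0%N => // n _ /=; apply: subset_closure.
  by exists (u n) => //; exists n.
move=> z [_ cz]; exists z => e N e0.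
have [||_ [[n Nn <-]]] := cz [set K (u n) | n in [set n | (N <= n)%N]] (ball z e).
- by exists N => // n /= Nn; exists n.
- exact: nbhsx_ballx.
by rewrite -ball_normE /= distrC; exists n.
Qed.

(** For approximate solutions [u n], the images [K (u n)] cluster at some [z], so
    [u n = (u n - K (u n)) + K (u n)] clusters at [y + z]. This point lies in the closed set [A] and
    is an exact solution by continuity of [K]. *)
Lemma compact_operator_approx_solution A (B : R) y : closed A ->
  (forall e : R, 0 < e ->
     exists x, [/\ A x, `|x| <= B & `|x - K x - y| < e]) ->
  exists2 x, A x & x - K x = y.
Proof.
move=> clA Ay.
have /choice[u uP] (n : nat) : exists x,
    [/\ A x, `|x| <= B & `|x - K x - y| < n.+1%:R^-1].
  by apply: Ay; rewrite invr_gt0.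
have [C C0 KC] := compact_operator_bounded.
have [z uz] : exists z, forall (e : R) (N : nat), 0 < e ->
    exists2 n, (N <= n)%N & `|K (u n) - z| < e.
  by apply: (@compact_operator_cluster B) => n; have [] := uP n.
have close (e : R) : 0 < e -> exists x,
    [/\ A x, `|x - (y + z)| < e & `|x - K x - y| < e].
  move=> e0.
  have e20 : 0 < e / 2 by rewrite divr_gt0.
  have [N _ Ne] := near_infty_natSinv_lt (PosNum e20).
  have [n Nn unz] := uz _ N e20.
  have [Aun _ /lt_trans/(_ (Ne n Nn))/= Kun] := uP n.
  exists (u n); split => //; last by rewrite (lt_trans Kun)// ltr_pdivrMr//; lra.
  rewrite -{1}(subrK (K (u n)) (u n)) opprD addrACA.
  by rewrite (le_lt_trans (ler_normD _ _))//; lra.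
exists (y + z).
  by apply: closed_approx => // e /close[x [Ax xyz _]]; exists x.
apply/eqP; rewrite -subr_eq0; apply/eqP/norm_le_eps => e e0.
(* The defect of [y + z] is at most that of [x], plus [|x - (y + z)|], plus [C] times the latter:
   [C + 2] small terms in all. *)
have d0 : 0 < e / (C + 2) by rewrite divr_gt0//; lra.
have [x [_ xyz Kx]] := close _ d0.
rewrite (le_trans (ler_distD (x - K x) _ _))//.
rewrite distrC -sub_idB (le_trans (lerD (ler_normB _ _) (lexx _)))//.
have := KC (x - (y + z)).
have : C * `|x - (y + z)| <= C * (e / (C + 2)) by rewrite ler_pM2l// ltW.
have : e = (C + 2) * (e / (C + 2)) by rewrite mulrC divfK// gt_eqF//; lra.
by lra.
Qed.

Section invariant_subspace.
Variable V : set X.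
Hypotheses (clV : closed V) (subV : linear_subspace V).
Hypothesis KV : forall x, V x -> V (K x).

(** If every [c] fails, normalizing the counterexamples gives approximate fixed points of norm 1,
    hence a true fixed point. *)
Lemma fixpoint_free_lower_bound :
  (forall x, V x -> K x = x -> x = 0) ->
  exists2 c : R, 0 < c & forall x, V x -> c * `|x| <= `|x - K x|.
Proof.
move=> fixV; apply: contrapT => /forall2NP noc.
(* The closed constraint [1 <= |x|] keeps the limiting fixed point away from 0. *)
have : exists2 x, (V `&` [set x | 1 <= `|x|]) x & x - K x = 0.
  apply: (@compact_operator_approx_solution _ 1).
    apply: closedI => //.
    have := @closed_comp X R (fun x => `|x|) [set r | 1 <= r] _ (@closed_ge _ 1).
    by apply => x _; exact: norm_continuous.
  move=> e e0; have [//|/existsNP[x /not_implyP[Vx /negP]]] := noc e.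
  rewrite -ltNge => Kx.
  have x0 : 0 < `|x|.
    rewrite normr_gt0; apply/eqP => x0; move: Kx.
    by rewrite x0 linear0 subrr !normr0 mulr0 ltxx.
  have nx1 : `|(`|x|^-1 *: x)| = 1.
    by rewrite normrZ ger0_norm ?invr_ge0// mulVf// gt_eqF.
  exists (`|x|^-1 *: x); split; [split| |].
  - exact: linear_subspaceZ.
  - by rewrite /= nx1.
  - by rewrite nx1.
  - rewrite subr0 linearZ -scalerBr normrZ ger0_norm ?invr_ge0//.
    by rewrite mulrC ltr_pdivrMr.
move=> [x [Vx /= x1] /eqP]; rewrite subr_eq0 => /eqP/esym/(fixV _ Vx) x0.
by move: x1; rewrite x0 normr0 ler10.
Qed.

Section lower_bound.
Variable c : R.
Hypotheses (c0 : 0 < c) (cV : forall x, V x -> c * `|x| <= `|x - K x|).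

Lemma sub_id_closed A : A `<=` V -> closed A ->
  closed [set x - K x | x in A].
Proof.
move=> AV clA y cly.
have : exists2 x, A x & x - K x = y; last by [].
(* Image points within distance 1 of [y] have norm at most [|y| + 1], and the lower bound then
   controls their preimages; hence the [Num.min e 1] below. *)
apply: (@compact_operator_approx_solution _ (c^-1 * (`|y| + 1))) => // e e0.
have [|_ [[x Ax <-]]] := cly (ball y (Num.min e 1)).
  by apply: nbhsx_ballx; rewrite lt_min e0 ltr01.
rewrite -ball_normE /= distrC lt_min => /andP[xye xy1].
exists x; split => //.
rewrite ler_pdivlMl// (le_trans (cV (AV _ Ax)))//.
rewrite -[X in `|X|](subrK y) (le_trans (ler_normD _ _))// addrC.
by rewrite lerD2l ltW.
Qed.

(** If [y] were not attained, the injective map [Id - K] would produce a strictly decreasing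
    sequence of closed subspaces [M n]. Almost orthogonal unit-ball vectors [u n] of [M n] then have
    images under [K] at mutual distance at least 1/2, contradicting compactness. *)
Lemma sub_id_surjective y : V y -> exists2 x, V x & x - K x = y.
Proof.
move=> Vy; apply: contrapT => nSy.
pose M n := iter n (fun A => [set x - K x | x in A]) V.
have MS n : M n.+1 = [set x - K x | x in M n] by [].
have subM n : linear_subspace (M n).
  elim: n => [//|n [M0 MP]]; rewrite MS; split.
    by exists 0 => //; rewrite linear0 subrr.
  move=> a _ _ [u Mu <-] [v Mv <-]; exists (a *: u + v); first exact: MP.
  by rewrite sub_idP.
have MSM n : M n.+1 `<=` M n.
  elim: n => [|n IH]; last by rewrite MS => _ [x /IH Mx <-]; exists x.
  by move=> _ [x Vx <-]; apply: linear_subspaceB => //; exact: KV.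
have Mle m n : (m <= n)%N -> M n `<=` M m.
  elim: n => [|n IH]; first by rewrite leqn0 => /eqP ->.
  rewrite leq_eqVlt => /predU1P[->//|/IH MnM].
  exact: (subset_trans (@MSM n)).
have MV n : M n `<=` V by exact: (Mle 0%N n).
have clM n : closed (M n).
  by elim: n => [//|n IH]; rewrite MS; exact: sub_id_closed.
(* [s n] witnesses strictness: it lies in [M n], and injectivity carries the failure for [y] over to
   each level. *)
pose s n := iter n (fun x => x - K x) y.
have Ms n : M n (s n) by elim: n => [//|n IH]; exists (s n).
have nMs n : ~ M n.+1 (s n).
  elim: n => [[x Vx xy]|n IH]; first by apply: nSy; exists x.
  move=> [x Mx] /= /eqP; rewrite -subr_eq0 -sub_idB => /eqP E.
  apply: IH; suff /eqP : x - s n = 0 by rewrite subr_eq0 => /eqP <-.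
  have Vxs : V (x - s n).
    by apply: linear_subspaceB => //; [exact: (MV n.+1)|exact: (MV n)].
  have := cV Vxs; rewrite E normr0 pmulr_rle0// normr_le0.
  by move/eqP.
have /choice[u uP] n : exists x,
    [/\ M n x, `|x| <= 1 & forall y, M n.+1 y -> 2^-1 <= `|x - y|].
  exact: riesz_almost_orthogonal (subM n) (clM _) (subM _) (@MSM n) (Ms n) (@nMs n).
have [z zP] : exists z, forall (e : R) (N : nat), 0 < e ->
    exists2 n, (N <= n)%N & `|K (u n) - z| < e.
  by apply: (@compact_operator_cluster 1) => n; have [] := uP n.
have e0 : 0 < 4^-1 :> R by lra.
have [m _ mz] := zP _ 0%N e0.
(* Starting at [m.+1] forces [m < n], so that [u n] and [K (u n)] lie in [M m.+1]. *)
have [n mn nz] := zP _ m.+1 e0.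
have [Mum _ um] := uP m; have [Mun _ _] := uP n.
(* Subtracting this point from [u m] leaves [K (u m) - K (u n)], whose norm is thus at least 1/2,
   while both images are within 1/4 of [z]. *)
have : M m.+1 (u m - K (u m) + K (u n)).
  apply: linear_subspaceD => //; first by exists (u m).
  have -> : K (u n) = u n - (u n - K (u n)) by rewrite subKr.
  apply: linear_subspaceB => //; first exact: Mle Mun.
  by apply: (Mle _ n.+1); [exact: leqW|exists (u n)].
move=> /um; rewrite opprD addrA subKr.
have := ler_distD z (K (u m)) (K (u n)).
by rewrite (distrC z); lra.
Qed.
End lower_bound.
End invariant_subspace.
End one_operator.
End compact_operators.

(** * Iterates of a compact operator: from pointwise to exponential decay *)

Section contraction.
Context (R : realType) (X : normedModType R) (K : {linear X -> X}).
Variable V : set X.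
Hypotheses (clV : closed V) (subV : linear_subspace V).
Hypothesis KV : forall x, V x -> V (K x).

Lemma iterB n (x y : X) : iter n K (x - y) = iter n K x - iter n K y.
Proof. by elim: n => [//|n /= ->]; rewrite linearB. Qed.

Lemma iterZ n a (x : X) : iter n K (a *: x) = a *: iter n K x.
Proof. by elim: n => [//|n /= ->]; rewrite linearZ. Qed.

Lemma iter_subspace n x : V x -> V (iter n K x).
Proof. by move=> Vx; elim: n => [//|n IH]; exact: KV. Qed.

Lemma iter_bound (B : R) n x : 0 <= B -> (forall x, `|K x| <= B * `|x|) ->
  `|iter n K x| <= B ^+ n * `|x|.
Proof.
move=> B0 KB; elim: n => [|n IH]; first by rewrite mul1r.
by rewrite (le_trans (KB _))// exprS -mulrA ler_wpM2l.
Qed.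

Hypothesis Kcpt : compact_operator K.

Let D n := [set `|iter n K x| | x in [set x | V x /\ `|x| <= 1]].
Let a n := sup (D n).

Let hasD n : has_sup (D n).
Proof.
have [B B0 KB] := compact_operator_bounded Kcpt; split.
  by exists `|iter n K 0|; exists 0; rewrite //= normr0; split; [case: subV|].
exists (B ^+ n) => _ [x [_ x1] <-].
rewrite (le_trans (iter_bound _ _ (ltW B0) KB))//.
by rewrite ler_piMr// exprn_ge0// ltW.
Qed.

Let le_a n x : V x -> `|iter n K x| <= a n * `|x|.
Proof.
move=> Vx; have [->|x0] := eqVneq x 0.
  by rewrite normr0 mulr0 -[0]subr0 iterB subrr normr0.
have nx : 0 < `|x| by rewrite normr_gt0.
rewrite -ler_pdivrMr// mulrC.
have -> : `|x|^-1 * `|iter n K x| = `|iter n K (`|x|^-1 *: x)|.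
  by rewrite iterZ normrZ ger0_norm// invr_ge0 ltW.
apply: ub_le_sup; first by have [] := hasD n.
exists (`|x|^-1 *: x) => //=; split; first exact: linear_subspaceZ.
by rewrite normrZ ger0_norm ?invr_ge0// mulVf// gt_eqF.
Qed.

Let a_ge0 n : 0 <= a n.
Proof.
have [[_ [x Vx _]] ubD] := hasD n.
by rewrite (le_trans (normr_ge0 (iter n K x)))// ub_le_sup//; exists x.
Qed.

(* Along infinitely many n the norms a n of K^n on V do not decrease by more
   than a factor 2, and then a point nearly realizing a n.+1 stays visible at a
   cluster point y of its images: |K^n y| >= a n.+1 / 4. *)
Lemma compact_contraction :
  (forall x, V x -> `|iter n K x| @[n --> \oo] --> (0 : R)) ->
  exists N, forall x, V x -> `|iter N K x| <= 2^-1 * `|x|.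
Proof.
move=> Kcvg; apply: contrapT => /forallNP nK.
have a_gt n : 2^-1 < a n.
  rewrite ltNge; apply/negP => an; apply: (nK n) => x Vx.
  by rewrite (le_trans (le_a _ Vx))// ler_wpM2r.
(* Otherwise [a] would more than halve at each step from [N] on, and would fall below 1/2. *)
have slow N : exists2 n, (N <= n)%N & a n <= 2 * a n.+1.
  apply: contrapT => /forall2NP aN.
  have decr k : a (N + k)%N <= 2^-1 ^+ k * a N.
    elim: k => [|k IH]; first by rewrite addn0 mul1r.
    have [/negP|/negP] := aN (N + k)%N; first by rewrite leq_addr.
    rewrite -ltNge addnS exprS => ak; have := le_lt_trans (lexx _) ak.
    by lra.
  have [k ak] : exists k : nat, 2 * a N < k%:R.
    by exists (Num.truncn (2 * a N)).+1; exact: truncnS_gt.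
  have k2 : k%:R <= 2 ^+ k :> R by rewrite -natrX ler_nat ltnW// ltn_expl.
  have := lt_le_trans (a_gt _) (decr k).
  by rewrite exprVn ltr_pdivlMl ?exprn_gt0//; lra.
have /choice[n nP] N : exists n, (N <= n)%N && (a n <= 2 * a n.+1).
  by have [n Nn an] := slow N; exists n; rewrite Nn.
have /choice[u uP] N : exists x,
    [/\ V x, `|x| <= 1 & a (n N).+1 / 2 < `|iter (n N).+1 K x|].
  have a0 : 0 < a (n N).+1 / 2 by have := a_gt (n N).+1; lra.
  have [_ [x [Vx x1] <-]] := sup_adherent a0 (hasD (n N).+1).
  by rewrite -/(a _) => ax; exists x; split => //; lra.
have [y yP] : exists z, forall (e : R) (N : nat), 0 < e ->
    exists2 n, (N <= n)%N & `|K (u n) - z| < e.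
  by apply: (@compact_operator_cluster _ _ _ Kcpt 1) => N; have [] := uP N.
have Vy : V y.
  apply: closed_approx => // e e0; have [N _ yN] := yP _ 0%N e0.
  by exists (K (u N)) => //; apply: KV; have [] := uP N.
(* With [a n <= 2 * a n.+1], replacing [K (u m)] by [y] costs at most [a n / 8 <= a n.+1 / 4]. So
   [|K^n y|] exceeds [a n.+1 / 4 > 1/8], against the convergence at [y]. *)
have e8 : 0 < 8^-1 :> R by lra.
have /cvgr0Pnorm_lt/(_ _ e8)[N _ Ny] := Kcvg _ Vy.
have [m Nm ym] := yP _ N e8.
have /andP[mn am] := nP m.
have [Vu u1] := uP m; rewrite iterSr => ua.
have /= := Ny (n m) (leq_trans Nm mn); rewrite normr_id => ny.
have := @le_a (n m) (K (u m) - y).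
rewrite iterB => /(_ (linear_subspaceB subV (KV Vu) Vy)) d.
have d' : a (n m) * `|K (u m) - y| <= a (n m) * 8^-1.
  by rewrite ler_wpM2l// ltW.
have := lerB_dist (iter (n m) K (K (u m))) (iter (n m) K y).
have := a_gt (n m).+1.
by lra.
Qed.

(** Write [n = q * N + r] with [r < N]: the [q] blocks contribute [2^-q], and the [r] remaining
    steps a bounded factor. *)
Lemma iter_half_exp_decay (N : nat) : (0 < N)%N ->
  (forall x, V x -> `|iter N K x| <= 2^-1 * `|x|) ->
  exists C lambda : R, [/\ 0 <= C, lambda < 0 &
    forall x, V x -> forall n : nat,
      `|iter n K x| <= C * expR (lambda * n%:R) * `|x|].
Proof.
move=> N0 KN.
have [B B0 KB] := compact_operator_bounded Kcpt.
have N0' : N%:R != 0 :> R by rewrite pnatr_eq0 -lt0n.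
have KqN q x : V x -> `|iter (q * N) K x| <= 2^-1 ^+ q * `|x|.
  move=> Vx; elim: q => [|q IH]; first by rewrite mul1r.
  rewrite mulSn iterD (le_trans (KN _ _))//; first exact: iter_subspace.
  by rewrite exprS -mulrA ler_wpM2l.
pose l : R := - (ln 2 / N%:R).
have l2 : 0 < ln 2 :> R by rewrite ln_gt0// ltr1n.
have lN : expR (l * N%:R) = 2^-1.
  by rewrite /l mulNr divfK// expRN lnK// posrE.
have l0 : l < 0 by rewrite /l oppr_lt0 divr_gt0// ltr0n.
(* Since [B + 1 >= 1], its power [N] dominates [B ^+ r] for all [r < N]; the factor 2 pays for
   rounding [n / N] down to [q]. *)
exists (2 * (B + 1) ^+ N), l; split => //.
  by rewrite mulr_ge0// exprn_ge0// addr_ge0// ltW.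
move=> x Vx n.
rewrite {1}(divn_eq n N) addnC iterD.
rewrite (le_trans (iter_bound _ _ (ltW B0) KB))//.
have Bn : 0 <= B ^+ (n %% N) by rewrite exprn_ge0// ltW.
rewrite (le_trans (ler_wpM2l Bn (KqN _ _ Vx)))//.
rewrite mulrA ler_wpM2r//.
have r_lt : (n %% N <= N)%N by rewrite ltnW// ltn_pmod.
have BN : B ^+ (n %% N) <= (B + 1) ^+ N.
  apply: (@le_trans _ _ ((B + 1) ^+ (n %% N))).
    by rewrite lerXn2r ?nnegrE ?addr_ge0 ?ltW// ltrDl.
  by rewrite ler_weXn2l// lerDr ltW.
have El : 2^-1 ^+ (n %/ N) <= 2 * expR (l * n%:R).
  rewrite -ler_pdivrMl// -lN -expRM_natr -expRD ler_expR.
  rewrite {2}(divn_eq n N) natrD natrM.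
  have : (n %% N)%:R <= N%:R :> R by rewrite ler_nat.
  move=> /(ler_wnM2l (ltW l0)).
  by lra.
have h0 : 0 <= 2^-1 ^+ (n %/ N) :> R by rewrite exprn_ge0// invr_ge0.
rewrite (le_trans (ler_wpM2r h0 BN))//.
have B10 : 0 <= (B + 1) ^+ N by rewrite exprn_ge0// addr_ge0// ltW.
by rewrite (le_trans (ler_wpM2l B10 El))// mulrCA mulrA.
Qed.

Lemma compact_exp_decay :
  (forall x, V x -> `|iter n K x| @[n --> \oo] --> (0 : R)) ->
  exists C lambda : R, [/\ 0 <= C, lambda < 0 &
    forall x, V x -> forall n : nat,
      `|iter n K x| <= C * expR (lambda * n%:R) * `|x|].
Proof.
move=> /compact_contraction[[|N] KN]; last exact: (iter_half_exp_decay _ KN).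
(* Here [N = 0]: the bound [|x| <= |x| / 2] makes [V] trivial, and block length 1 serves. *)
apply: (@iter_half_exp_decay 1) => // x Vx.
have x0 : x = 0 by apply/eqP; rewrite -normr_le0; have /= := KN _ Vx; lra.
by rewrite x0 /= linear0 normr0 mulr0.
Qed.
End contraction.

(** * The integral on L^2([0, 1]) *)

Section integral01.
Context (R : realType).
Local Notation mu := (lebesgue01 R).
Implicit Types f g : L2 R.

Lemma lebesgue01_setT : mu [set: _] = 1%E.
Proof.
rewrite /lebesgue01 /= /mrestr setTI.
by rewrite lebesgue_measure_itv/= lte_fin ltr01 oppr0 adde0.
Qed.

Lemma L2_Lfun f : (f : R -> R) \in Lfun mu 2%:E.
Proof. exact: (LfunP (Lspace_repr f)). Qed.

Lemma L2_integrable f : mu.-integrable setT (EFin \o (f : R -> R)).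
Proof.
apply/Lfun1_integrable; apply: Lfun_subset12; last exact: L2_Lfun.
by rewrite lebesgue01_setT.
Qed.

Lemma L2_measurable f : measurable_fun setT (f : R -> R).
Proof. by have /integrableP[/measurable_EFinP] := L2_integrable f. Qed.

Lemma integral01P a f g :
  integral01 (a *: f + g) = a * integral01 f + integral01 g.
Proof.
have af : mu.-integrable setT (EFin \o (fun x => a * f x)).
  by apply: (integrableZl _ a (L2_integrable f)).
rewrite /integral01 -RintegralZl ?L2_integrable// -RintegralD ?L2_integrable//.
congr fine; apply: ae_eq_integral => //.
- exact: measurable_int (L2_integrable _).
- apply/measurable_EFinP; apply: measurable_funD; last exact: L2_measurable.
  by apply: measurable_funM => //; exact: L2_measurable.
move: (Lspace_addE (a *: f) g) (Lspace_scaleE a f).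
by apply: filterS2 => x /= fg af' _; rewrite fg// af'.
Qed.

(** Hölder's inequality against the constant 1, whose norm is 1 since the total mass is 1. *)
Lemma integral01_le_norm f : `|integral01 f| <= `|f|.
Proof.
rewrite /integral01 (le_trans (le_normr_Rintegral _ (L2_integrable f)))//.
rewrite Lspace_normE.
have mf := L2_measurable f.
have := @hoelder _ _ _ mu (f : R -> R) (cst 1) 2 2 mf (measurable_cst _).
have -> : 2^-1 + 2^-1 = 1 :> R by lra.
move=> /(_ (ltr0Sn _ _) (ltr0Sn _ _) erefl).
rewrite Lnorm_cst1 lebesgue01_setT poweR1r mule1 Lnorm1 => h.
have -> : \int[mu]_x `|f x| = fine (\int[mu]_x `|((f : R -> R) \* cst 1) x|%:E)%E.
  by congr fine; apply: eq_integral => x _ /=; rewrite mulr1.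
have N2fin : ('N[mu]_2[EFin \o f] < +oo)%E.
  by have := L2_Lfun f; rewrite inE => /andP[_]; rewrite inE.
apply: fine_le => //; rewrite ge0_fin_numE ?integral_ge0 ?Lnorm_ge0//.
exact: le_lt_trans h N2fin.
Qed.

Lemma integral01_one : exists f, integral01 f = 1.
Proof.
have c1 : (cst 1 : R -> R) \in Lfun mu 2%:E.
  apply/andP; split; rewrite inE//=.
  by rewrite /finite_norm Lnorm_cst1 lebesgue01_setT poweR1r ltry.
exists (Lspace_class (Lfun_Sub (lee1n 2) c1)).
rewrite /integral01.
transitivity (\int[mu]_x (cst 1 x)); last first.
  by rewrite Rintegral_cst// lebesgue01_setT mulr1.
congr fine; apply: ae_eq_integral => //.
  exact: measurable_int (L2_integrable _).
  by apply/measurable_EFinP; exact: measurable_cst.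
by apply: filterS (Lspace_classE (Lfun_Sub (lee1n 2) c1)) => x /= ->.
Qed.
End integral01.

(** * Invariant functions and linear response *)

Lemma operator_norm_le (R : realType) (U W : normedModType R)
    (T : {linear U -> W}) (M : R) x :
  (operator_norm T <= M%:E)%E -> `|T x| <= M * `|x|.
Proof.
move=> TM; have [->|x0] := eqVneq x 0; first by rewrite linear0 !normr0 mulr0.
have nx : 0 < `|x| by rewrite normr_gt0.
rewrite -ler_pdivrMr// mulrC.
have -> : `|x|^-1 * `|T x| = `|T (`|x|^-1 *: x)|.
  by rewrite linearZ/= normrZ ger0_norm// invr_ge0 ltW.
rewrite -lee_fin (le_trans _ TM)//; apply: ereal_sup_ubound.
exists (`|x|^-1 *: x) => //=.
by rewrite normrZ ger0_norm ?invr_ge0// mulVf// gt_eqF.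
Qed.

Section invariant_functions.
Context (R : realType).
Local Notation V := (@zero_average R).
Implicit Types f g : L2 R.

Lemma integral01_0 : integral01 (0 : L2 R) = 0.
Proof. by have := integral01P 1 (0 : L2 R) 0; rewrite scale1r addr0; lra. Qed.

Lemma integral01Z a f : integral01 (a *: f) = a * integral01 f.
Proof. by rewrite -[_ *: _]addr0 integral01P integral01_0 addr0. Qed.

Lemma integral01B f g : integral01 (f - g) = integral01 f - integral01 g.
Proof. by rewrite addrC -scaleN1r integral01P; lra. Qed.

Lemma zero_average_subspace : linear_subspace V.
Proof.
split; first exact: integral01_0.
by move=> a f g f0 g0; rewrite /zero_average /= integral01P f0 g0 mulr0 addr0.
Qed.

Lemma zero_average_closed : closed V.
Proof.
move=> g clg; apply: norm_le_eps => e e0.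
have [|f [f0]] := clg (ball g e); first exact: nbhsx_ballx.
rewrite -ball_normE /= => gf; rewrite -[integral01 g]subr0 -[X in _ - X]f0.
by rewrite -integral01B (le_trans (integral01_le_norm _))// ltW.
Qed.

Variable T : {linear L2 R -> L2 R}.
Hypotheses (T_compact : compact_operator T) (T_integral : preserves_integral T).

Lemma preserves_zero_average g : V g -> V (T g).
Proof. by move=> g0; rewrite /zero_average /= T_integral. Qed.

Lemma invariant_function_ex : exists g : L2 R, g != 0 /\ T g = g.
Proof.
apply: contrapT => /forallNP noinv.
have fixT g : [set: L2 R] g -> T g = g -> g = 0.
  by move=> _ Tg; apply/eqP/negPn/negP => g0; exact: (noinv g).
have subT : linear_subspace [set: L2 R] by [].
have invT (g : L2 R) : [set: L2 R] g -> [set: L2 R] (T g) by [].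
(* The Riesz theory is applied on the whole space; a preimage of a function of integral 1 is then
   impossible, as [g - T g] has integral 0. *)
have [c c0 cT] := fixpoint_free_lower_bound T_compact closedT subT fixT.
have [f f1] := integral01_one R.
have [//|g _ gf] := sub_id_surjective T_compact closedT subT invT c0 cT (y := f).
move: f1; rewrite -gf integral01B T_integral subrr => /esym/eqP.
by rewrite oner_eq0.
Qed.

(** A nonzero invariant function cannot lie in [V], so it can be normalized; two normalized ones
    differ by a fixed point in [V]. *)
Lemma normalized_invariant_unique :
  (forall g, V g -> T g = g -> g = 0) ->
  exists! f, normalized_invariant T f.
Proof.
move=> fixV; have [g [g0 Tg]] := invariant_function_ex.
have ig0 : integral01 g != 0.
  by apply/eqP => ig; move: g0; rewrite (fixV g)// eqxx.
exists ((integral01 g)^-1 *: g); split.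
  by split; [rewrite linearZ/= Tg|rewrite integral01Z mulVf].
move=> f [Tf f1]; apply/eqP; rewrite -subr_eq0; apply/eqP/fixV.
  by rewrite /zero_average /= integral01B integral01Z mulVf// f1 subrr.
by rewrite linearB linearZ/= Tg Tf.
Qed.

Hypothesis T_equilibrium : convergence_to_equilibrium T.

Lemma equilibrium_fixpoint_eq0 g : V g -> T g = g -> g = 0.
Proof.
move=> Vg Tg; have := T_equilibrium Vg.
have -> : (fun n => `|iter n T g|) = (fun=> `|g|).
  by apply/funext => n; congr `|_|; elim: n => [//|n /= ->].
move=> g0; apply/eqP; rewrite -normr_eq0; apply/eqP.
exact: cvg_unique (cvg_cst _) g0.
Qed.

Lemma equilibrium_lower_bound :
  exists2 c : R, 0 < c & forall g, V g -> c * `|g| <= `|g - T g|.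
Proof.
exact: (fixpoint_free_lower_bound T_compact zero_average_closed
  zero_average_subspace equilibrium_fixpoint_eq0).
Qed.

Lemma equilibrium_set_bij : set_bij V V (fun g => g - T g).
Proof.
have [c c0 cV] := equilibrium_lower_bound.
split.
- move=> g Vg; apply: linear_subspaceB => //; first exact: zero_average_subspace.
  exact: preserves_zero_average.
- move=> f g /[!inE] Vf Vg /eqP; rewrite -subr_eq0 -sub_idB => /eqP fg.
  have := cV _ (linear_subspaceB zero_average_subspace Vf Vg).
  by rewrite fg normr0 pmulr_rle0// normr_le0 subr_eq0 => /eqP.
- move=> g Vg; have [f Vf fg] := sub_id_surjective T_compact zero_average_closed
    zero_average_subspace preserves_zero_average c0 cV Vg.
  by exists f.
Qed.

(** By surjectivity onto [V], the default value 0 of the partial inverse is never taken for want of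
    a preimage. *)
Lemma resolventK g : V g -> resolvent T g - T (resolvent T g) = g.
Proof.
have [_ _ surjT] := equilibrium_set_bij.
move=> Vg; apply: (@surjpK _ _ (fun=> 0) V _ (fun g => g - T g) surjT).
by rewrite inE.
Qed.

Lemma resolvent_zero_average g : V g -> V (resolvent T g).
Proof.
have [VV _ _] := bijpinv_bij (fun=> 0) equilibrium_set_bij.
exact: VV.
Qed.

(** The lower bound [c] makes the resolvent Lipschitz on [V] with constant [1 / c]. *)
Lemma resolvent_continuous : {within V, continuous (resolvent T)}.
Proof.
have [c c0 cV] := equilibrium_lower_bound.
apply/subspace_continuousP => f Vf; apply/cvgrPdist_le => e e0.
have : \forall g \near f, `|f - g| <= c * e.
  apply: (@cvgr_dist_le _ _ _ (nbhs f) _ id f) => //; last exact: mulr_gt0.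
apply: filterS => g fg Vg /=.
have := cV _ (linear_subspaceB zero_average_subspace
  (resolvent_zero_average Vf) (resolvent_zero_average Vg)).
by rewrite sub_idB !resolventK// => /le_trans/(_ fg); rewrite ler_pM2l.
Qed.

End invariant_functions.

(** * Perturbation of the lower bound and linear response *)

Section linear_response.
Context (R : realType) (T0 : {linear L2 R -> L2 R}).
Hypotheses (T0_compact : compact_operator T0)
  (T0_integral : preserves_integral T0)
  (T0_equilibrium : convergence_to_equilibrium T0).
Local Notation V := (@zero_average R).

Lemma perturbed_lower_bound (T : {linear L2 R -> L2 R}) (c m : R) :
  (forall g, V g -> c * `|g| <= `|g - T0 g|) ->
  (forall g, `|T g - T0 g| <= m * `|g|) -> m <= c / 2 ->
  forall g, V g -> c / 2 * `|g| <= `|g - T g|.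
Proof.
move=> cV Tm mc g Vg.
have := ler_distD (T g) g (T0 g).
have := cV _ Vg; have := Tm g; have := ler_wpM2r (normr_ge0 g) mc.
by lra.
Qed.

(** With [h] the difference quotient and [w] the resolvent at [fhat], [(Id - T0) (h - w) = (r -
    fhat) + (T - T0) h]. The perturbed lower bound [c / 2] controls [h] by [r]. *)
Lemma response_estimate (T : {linear L2 R -> L2 R}) (c m d : R)
    (f f0 fhat r : L2 R) :
  0 < c -> 0 < d ->
  (forall g, V g -> c * `|g| <= `|g - T0 g|) ->
  (forall g, `|T g - T0 g| <= m * `|g|) -> 0 <= m <= c / 2 ->
  normalized_invariant T f -> normalized_invariant T0 f0 -> V fhat ->
  r = d^-1 *: (T f0 - T0 f0) ->
  c * `|d^-1 *: (f - f0) - resolvent T0 fhat| <=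
  `|r - fhat| + m * (2 / c * `|r|).
Proof.
move=> c0 d0 cV Tm /andP[m0 mc] [Tf f1] [T0f0 f01] Vfhat rE.
pose h : L2 R := d^-1 *: (f - f0); rewrite -/h; set w := resolvent T0 fhat.
have Vh : V h.
  by rewrite /zero_average /= integral01Z integral01B f1 f01 subrr mulr0.
have Vw : V w by exact: resolvent_zero_average.
have hr : h - T h = r.
  rewrite /h rE linearZ -scalerBr [T (f - f0)]linearB Tf T0f0; congr (_ *: _).
  by rewrite opprB addrC subrKA.
have hle : `|h| <= 2 / c * `|r|.
  have := perturbed_lower_bound cV Tm mc Vh; rewrite hr.
  by rewrite -[2 / c]invf_div ler_pdivlMl ?divr_gt0.
have := cV _ (linear_subspaceB (zero_average_subspace R) Vh Vw).
rewrite sub_idB [w - T0 w]resolventK// => /le_trans; apply.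
rewrite -[h - T0 h](subrKA (T h)) hr addrAC (le_trans (ler_normD _ _))// lerD2l.
by rewrite (le_trans (Tm _))// ler_wpM2l.
Qed.

End linear_response.

Theorem theorem2p2 (R : realType) (dbar : R) (L : R -> {linear L2 R -> L2 R})
  (dbar_gt0 : 0 < dbar)
  (L_compact : forall d : R, 0 <= d < dbar -> compact_operator (L d))
  (L_integral : forall d : R, 0 <= d < dbar -> preserves_integral (L d)) :
  [/\ forall d : R, 0 <= d < dbar -> exists g : L2 R, g != 0 /\ L d g = g,
      convergence_to_equilibrium (L 0) ->
      (exists! f0 : L2 R, normalized_invariant (L 0) f0) /\
      exponential_contraction (L 0)
    & convergence_to_equilibrium (L 0) ->
      forall f0 : L2 R, normalized_invariant (L 0) f0 ->
      (exists2 K : R, 0 <= K &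
        \forall d \near (0 : R)^'+,
          (operator_norm (L d \- L 0)%R <= (K * d)%:E)%E) ->
      forall fhat : L2 R, zero_average fhat ->
      d^-1 *: (L d f0 - L 0 f0) @[d --> (0 : R)^'+] --> fhat ->
      exists2 d2 : R, 0 < d2 <= dbar &
      [/\ forall d : R, 0 <= d < d2 ->
            exists! f : L2 R, normalized_invariant (L d) f,
          set_bij (@zero_average R) (@zero_average R) (fun g => g - L 0 g) /\
          {within @zero_average R, continuous (resolvent (L 0))}
        & forall f : R -> L2 R,
            (forall d : R, 0 <= d < d2 -> normalized_invariant (L d) (f d)) ->
            `|d^-1 *: (f d - f0) - resolvent (L 0) fhat| @[d --> (0 : R)^'+]
              --> (0 : R)]].
Proof.
have h0 : 0 <= (0 : R) < dbar by rewrite lexx.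
have cpt0 := L_compact _ h0; have int0 := L_integral _ h0.
split.
- by move=> d hd; apply: invariant_function_ex; [exact: L_compact|exact: L_integral].
- move=> eq0; split.
    by apply: normalized_invariant_unique => // g; exact: equilibrium_fixpoint_eq0.
  exact: compact_exp_decay (@zero_average_closed R) (zero_average_subspace R)
    (preserves_zero_average int0) cpt0 eq0.
move=> eq0 f0 inv0 [K K0 opK] fhat Vfhat rfhat.
have [c c0 cV] := equilibrium_lower_bound cpt0 eq0.
have smallK : \forall d \near (0 : R)^'+, 0 <= K * d <= c / 2 /\
    forall g, `|L d g - L 0 g| <= K * d * `|g|.
  near=> d; split; last first.
    by move=> g; apply: (@operator_norm_le _ _ _ (L d \- L 0)%R); near: d.
  rewrite mulr_ge0//=.
  (* [K + 1] replaces [K] as divisor, since [K] may be 0. *)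
  have : d < c / 2 / (K + 1).
    by near: d; apply: nbhs_right_lt; rewrite !divr_gt0// ltr_wpDl.
  rewrite ltr_pdivlMr ?ltr_wpDl// => /ltW; apply: le_trans.
  by rewrite mulrC ler_pM2l// lerDl.
have /nbhs_ballP[e /= e0 small] := smallK.
have d2_gt0 : 0 < Num.min dbar e by rewrite lt_min dbar_gt0.
exists (Num.min dbar e); first by rewrite d2_gt0 ge_min lexx.
split.
- move=> d /andP[d0]; rewrite lt_min => /andP[d_dbar de].
  have hd : 0 <= d < dbar by rewrite d0.
  apply: normalized_invariant_unique; [exact: L_compact|exact: L_integral|].
  (* The filter at [0^'+] says nothing about [d = 0], where (A1) gives uniqueness directly. *)
  move: d0; rewrite le_eqVlt => /predU1P[<-|d0].
    by move=> g; exact: equilibrium_fixpoint_eq0.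
  have [|/andP[_ Kdc] LdK] := small d _ d0.
    by rewrite -ball_normE /= sub0r normrN gtr0_norm.
  move=> g Vg Ldg; have := perturbed_lower_bound cV LdK Kdc Vg.
  by rewrite Ldg subrr normr0 pmulr_rle0 ?divr_gt0// normr_le0 => /eqP.
- by split; [exact: equilibrium_set_bij|exact: resolvent_continuous].
move=> f invf; apply/cvgr0Pnorm_le => eps eps0.
(* [M] eventually bounds [r], which tends to [fhat]. In [B], the coefficient of [d] in the
   perturbation error, the added 1 ensures positivity. *)
pose M := `|fhat| + 1.
have M0 : 0 < M by rewrite ltr_wpDl.
pose B := K * (2 / c) * M + 1.
have B0 : 0 < B.
  by rewrite ltr_wpDl// (mulr_ge0 _ (ltW M0))// mulr_ge0// divr_ge0// ltW.
near=> d; rewrite normr_id -(ler_pM2l c0).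
have d0 : 0 < d by [].
have [Kdc LdK] : 0 <= K * d <= c / 2 /\
  forall g, `|L d g - L 0 g| <= K * d * `|g| by near: d.
have invfd : normalized_invariant (L d) (f d).
  by apply: invf; rewrite ltW//=; near: d; exact: nbhs_right_lt.
have := response_estimate cpt0 int0 eq0 c0 d0 cV LdK Kdc invfd inv0 Vfhat erefl.
move=> /le_trans; apply.
set r := _ *: (_ - _).
have rM : `|r| <= M.
  by apply/ltW; rewrite /r; near: d; apply: (cvgr_norm_lt _ rfhat); rewrite /M ltrDl.
have rc : `|r - fhat| <= c * eps / 2.
  rewrite distrC /r; near: d; apply: (cvgr_dist_le _ _ rfhat).
  by rewrite divr_gt0// mulr_gt0.
have dB : d * B <= c * eps / 2.
  rewrite -ler_pdivlMr//; near: d; apply: nbhs_right_le.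
  by rewrite !divr_gt0// mulr_gt0.
have Kr : K * d * (2 / c * `|r|) <= d * (K * (2 / c) * M).
  have -> : d * (K * (2 / c) * M) = K * d * (2 / c * M) by ring.
  rewrite ler_wpM2l//; first by case/andP: Kdc.
  by rewrite ler_wpM2l// divr_ge0// ltW.
move: dB; rewrite /B mulrDr mulr1; lra.
Unshelve. all: by end_near. Qed.
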